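(* Let $\mathbf{k}$ be a field and let $(X,r_f)$, $(Y,r_\varphi)$ be finite permutation idempotent solutions on disjoint sets $X=\{x_1,\dots,x_m\}$, $Y=\{y_1,\dots,y_n\}$, $m,n\ge2$, with Yang-Baxter algebras $A=\mathcal{A}(\mathbf{k},X,r_f)$, $B=\mathcal{A}(\mathbf{k},Y,r_\varphi)$. Let $Z=\{z_{11},z_{12},\dots,z_{mn}\}$ be a set of order $mn$ disjoint from $X$ and $Y$, let $(Z,r_\Phi)$ be the permutation idempotent solution with $\Phi\in\mathrm{Sym}(Z)$ given by $\Phi(z_{ia})=z_{pq}$ iff $f(x_i)=x_p$ and $\varphi(y_a)=y_q$, and let $A_Z=\mathcal{A}(\mathbf{k},Z,r_\Phi)$. Then the image of the Segre map $s_{m,n}:A_Z\to A\otimes_{\mathbf{k}}B$ is the Segre product $A\circ B$. Moreover, the Segre map is an isomorphism of graded algebras $s_{m,n}:A_Z\to A\circ B$.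
   Context: For a finite set $Z$ and $g\in\mathrm{Sym}(Z)$, the permutation idempotent solution $(Z,r_g)$ is $r_g(x,y)=(g(y),y)$ on $Z\times Z$, and its Yang-Baxter algebra is $\mathcal{A}(\mathbf{k},Z,r_g)=\mathbf{k}\langle Z\rangle/(xy-g(y)y\mid x,y\in Z)$, graded by word length. The Segre product of graded algebras $A,B$ with $A_0=B_0=\mathbf{k}$ is the graded algebra $A\circ B=\bigoplus_{i\ge0}A_i\otimes_{\mathbf{k}}B_i$ with $(A\circ B)_i=A_i\otimes B_i$, a subalgebra of $A\otimes_{\mathbf{k}}B$. The $(m,n)$-Segre map $s_{m,n}:A_Z\to A\otimes_{\mathbf{k}}B$ is the (well-defined) algebra homomorphism extending the assignment $z_{ia}\mapsto x_i\otimes y_a$, $1\le i\le m$, $1\le a\le n$. *)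

(* Defs.v *)
From HB Require Import structures.
From mathcomp Require Import all_boot perm all_algebra.
From mathcomp Require Import boolp classical_sets.
From mathcomp Require Import finmap monalg.

Set Implicit Arguments.
Unset Strict Implicit.
Unset Printing Implicit Defensive.

Import GRing.Theory.
Local Open Scope ring_scope.
Local Open Scope quotient_scope.

Section Span.
Variables (k : fieldType) (V : lmodType k).

Inductive span (S : V -> Prop) : V -> Prop :=
| span_0 : span S 0
| span_lin c s v of S s & span S v : span S (c *: s + v).

Implicit Type S : V -> Prop.

Lemma span_mem S s : S s -> span S s.
Proof.
move=> Ss; rewrite -[s]scale1r -[_ *: _]addr0.
by apply: span_lin => //; exact: span_0.
Qed.

Lemma spanD S u v : span S u -> span S v -> span S (u + v).
Proof.
move=> + Sv; elim=> [|c s w Ss _ IH]; first by rewrite add0r.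
by rewrite -addrA; apply: span_lin.
Qed.

Lemma spanZ S c u : span S u -> span S (c *: u).
Proof.
elim=> [|d s w Ss _ IH]; first by rewrite scaler0; exact: span_0.
by rewrite scalerDr scalerA; apply: span_lin.
Qed.

Lemma spanZD S c u v : span S u -> span S v -> span S (c *: u + v).
Proof. by move=> Su Sv; apply: spanD => //; apply: spanZ. Qed.

Lemma spanB S u v : span S u -> span S v -> span S (u - v).
Proof.
by move=> Su Sv; rewrite -scaleN1r; apply: spanD => //; apply: spanZ.
Qed.

Lemma span_min S (T : V -> Prop) : T 0 ->
    (forall c u v, T u -> T v -> T (c *: u + v)) ->
  (forall s, S s -> T s) -> forall v, span S v -> T v.
Proof. by move=> T0 TD ST v; elim=> // c s w /ST Ts _ Tw; apply: TD. Qed.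

Lemma span_sum S I (r : seq I) (P : pred I) (F : I -> V) :
  (forall i, P i -> span S (F i)) -> span S (\sum_(i <- r | P i) F i).
Proof. by move=> SF; apply: big_ind => //; [exact: span_0 | exact: spanD]. Qed.

Definition span_pred S : {pred V} := fun v => `[< span S v >].

Lemma span_predP S v : reflect (span S v) (v \in span_pred S).
Proof. exact: asboolP. Qed.

Lemma span_zmod_closed S : zmod_closed (span_pred S).
Proof.
split=> [|u v /span_predP Su /span_predP Sv]; apply/span_predP.
- exact: span_0.
- exact: spanB.
Qed.
HB.instance Definition _ S :=
  GRing.isZmodClosed.Build V (span_pred S) (span_zmod_closed S).

End Span.

Lemma span_map (k : fieldType) (V W : lmodType k) (f : {linear V -> W})
    (S : V -> Prop) (T : W -> Prop) :
  (forall s, S s -> span T (f s)) -> forall v, span S v -> span T (f v).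
Proof.
move=> ST; apply: span_min => //; first by rewrite linear0; exact: span_0.
by move=> c u v Tu Tv; rewrite linearP; apply: spanZD.
Qed.

(* Keeps conversion from unfolding the operations on quotients. *)
Fact quot_key : unit. Proof. exact: tt. Qed.

(* Quotient of a vector space by the subspace spanned by S. *)
Section LmodQuotient.
Variables (k : fieldType) (V : lmodType k) (S : V -> Prop).

Definition lmodquot := {ideal_quot span_pred S}.
HB.instance Definition _ := GRing.Zmodule.on lmodquot.

Definition proj (v : V) : lmodquot := \pi_lmodquot v.

Lemma projK (t : lmodquot) : proj (repr t) = t.
Proof. exact: reprK. Qed.

Lemma projP u v : proj u = proj v <-> span S (u - v).
Proof.
split=> [|Suv]; rewrite /proj.
  by move/eqP; rewrite -Quotient.idealrBE => /span_predP.
by apply/eqP; rewrite -Quotient.idealrBE; apply/span_predP.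
Qed.

Lemma proj0P u : proj u = 0 <-> span S u.
Proof.
have -> : 0 = proj 0 by rewrite /proj piE.
by rewrite projP subr0.
Qed.

Lemma projD : {morph proj : u v / u + v}.
Proof. by move=> u v; rewrite /proj piE. Qed.

Definition lmodquot_scale : k -> lmodquot -> lmodquot :=
  locked_with quot_key (fun c t => proj (c *: repr t)).

Lemma lmodquot_scaleE c v : lmodquot_scale c (proj v) = proj (c *: v).
Proof.
rewrite /lmodquot_scale locked_withE.
by apply/projP; rewrite -scalerBr; apply/spanZ/projP; rewrite projK. Qed.

Lemma projW (P : lmodquot -> Prop) : (forall v, P (proj v)) -> forall t, P t.
Proof. by move=> Pp t; rewrite -[t]projK. Qed.

Fact lmodquot_scaleA a b t :
  lmodquot_scale a (lmodquot_scale b t) = lmodquot_scale (a * b) t.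
Proof. by elim/projW: t => v; rewrite !lmodquot_scaleE scalerA. Qed.
Fact lmodquot_scale1 : left_id 1 lmodquot_scale.
Proof. by elim/projW => v; rewrite lmodquot_scaleE scale1r. Qed.
Fact lmodquot_scaleDr : right_distributive lmodquot_scale +%R.
Proof.
move=> a; elim/projW => u; elim/projW => v.
by rewrite -projD !lmodquot_scaleE scalerDr projD.
Qed.
Fact lmodquot_scaleDl t : {morph lmodquot_scale^~ t : a b / a + b}.
Proof.
by move=> a b; elim/projW: t => v; rewrite !lmodquot_scaleE scalerDl projD.
Qed.
HB.instance Definition _ := GRing.Zmodule_isLmodule.Build k lmodquot
  lmodquot_scaleA lmodquot_scale1 lmodquot_scaleDr lmodquot_scaleDl.

Fact proj_is_linear : linear proj.
Proof. by move=> c u v; rewrite projD -lmodquot_scaleE. Qed.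
HB.instance Definition _ := GRing.isLinear.Build k V lmodquot *:%R proj
  proj_is_linear.

End LmodQuotient.

(* Quotient of an algebra by the two-sided ideal generated by S, the ideal   *)
(* being assumed proper because the rings underlying an algType are nonzero. *)
Section AlgQuotient.
Variables (k : fieldType) (R : algType k).
Implicit Type S : R -> Prop.

Definition sandwich S : R -> Prop :=
  fun u => exists a s b, S s /\ u = a * s * b.

Definition ideal S : R -> Prop := span (sandwich S).

Lemma ideal_mem S s : S s -> ideal S s.
Proof. by move=> Ss; apply: span_mem; exists 1, s, 1; rewrite mul1r mulr1. Qed.

Lemma idealMl S a u : ideal S u -> ideal S (a * u).
Proof.
move: u; apply: span_min => [|c u v Su Sv|_ [b [s [d [Ss ->]]]]].
- by rewrite mulr0; exact: span_0.
- by rewrite mulrDr -scalerAr; apply: spanZD.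
- by apply: span_mem; exists (a * b), s, d; rewrite !mulrA.
Qed.

Lemma idealMr S a u : ideal S u -> ideal S (u * a).
Proof.
move: u; apply: span_min => [|c u v Su Sv|_ [b [s [d [Ss ->]]]]].
- by rewrite mul0r; exact: span_0.
- by rewrite mulrDl -scalerAl; apply: spanZD.
- by apply: span_mem; exists b, s, (d * a); rewrite !mulrA.
Qed.

Variables (S : R -> Prop) (S_proper : ~ ideal S 1).

Definition algquot of ~ ideal S 1 := lmodquot (sandwich S).
Local Notation Q := (algquot S_proper).
Local Notation L := (lmodquot (sandwich S)).
(* The vector space instances are rebuilt instead of inherited from lmodquot *)
(* because unification through inherited instances is very slow here.       *)
HB.instance Definition _ := Choice.on Q.
Definition algquot_add : Q -> Q -> Q := @Algebra.add L.
Definition algquot_opp : Q -> Q := @Algebra.opp L.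
Definition algquot_zero : Q := 0 : L.
Definition algquot_scale : k -> Q -> Q := @GRing.scale k L.
Fact algquot_addA : associative algquot_add. Proof. exact: (@addrA L). Qed.
Fact algquot_addC : commutative algquot_add. Proof. exact: (@addrC L). Qed.
Fact algquot_add0 : left_id algquot_zero algquot_add.
Proof. exact: (@add0r L). Qed.
Fact algquot_addN : left_inverse algquot_zero algquot_opp algquot_add.
Proof. exact: (@addNr L). Qed.
HB.instance Definition _ :=
  GRing.isZmodule.Build Q algquot_addA algquot_addC algquot_add0 algquot_addN.
Fact algquot_scalerA c d t :
  algquot_scale c (algquot_scale d t) = algquot_scale (c * d) t.
Proof. exact: (@scalerA k L). Qed.
Fact algquot_scale1r : left_id 1 algquot_scale.
Proof. exact: (@scale1r k L). Qed.
Fact algquot_scalerDr : right_distributive algquot_scale +%R.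
Proof. exact: (@scalerDr k L). Qed.
Fact algquot_scalerDl t : {morph algquot_scale^~ t : c d / c + d}.
Proof. by move=> c d; exact: (@scalerDl k L). Qed.
HB.instance Definition _ := GRing.Zmodule_isLmodule.Build k Q
  algquot_scalerA algquot_scale1r algquot_scalerDr algquot_scalerDl.

Definition algproj : R -> Q := @proj k R (sandwich S).
Fact algproj_is_linear : linear algproj.
Proof. exact: proj_is_linear. Qed.
HB.instance Definition _ := GRing.isLinear.Build k R Q *:%R algproj
  algproj_is_linear.

Lemma algprojP u v : algproj u = algproj v <-> ideal S (u - v).
Proof. exact: projP. Qed.

Lemma algproj0P u : algproj u = 0 <-> ideal S u.
Proof. exact: proj0P. Qed.

Lemma algprojW (P : Q -> Prop) : (forall v, P (algproj v)) -> forall t, P t.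
Proof. exact: projW. Qed.

Definition algquot_mul : Q -> Q -> Q :=
  locked_with quot_key (fun t u => algproj (repr t * repr u)).

Lemma algquot_mulE u v : algquot_mul (algproj u) (algproj v) = algproj (u * v).
Proof.
rewrite /algquot_mul locked_withE; apply/algprojP.
set u' := repr _; set v' := repr _.
have Su : ideal S (u' - u) by apply/algprojP; exact: projK.
have Sv : ideal S (v' - v) by apply/algprojP; exact: projK.
rewrite (_ : _ - _ = u' * (v' - v) + (u' - u) * v).
  by apply: spanD; [exact: idealMl | exact: idealMr].
by rewrite mulrBr mulrBl addrA subrK.
Qed.

Fact algquot_mulA : associative algquot_mul.
Proof.
by elim/algprojW=> u; elim/algprojW=> v; elim/algprojW=> w;
  rewrite !algquot_mulE mulrA.
Qed.
Fact algquot_mul1l : left_id (algproj 1) algquot_mul.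
Proof. by elim/algprojW=> u; rewrite algquot_mulE mul1r. Qed.
Fact algquot_mul1r : right_id (algproj 1) algquot_mul.
Proof. by elim/algprojW=> u; rewrite algquot_mulE mulr1. Qed.
Fact algquot_mulDl : left_distributive algquot_mul +%R.
Proof.
elim/algprojW=> u; elim/algprojW=> v; elim/algprojW=> w.
by rewrite -raddfD !algquot_mulE mulrDl raddfD.
Qed.
Fact algquot_mulDr : right_distributive algquot_mul +%R.
Proof.
elim/algprojW=> u; elim/algprojW=> v; elim/algprojW=> w.
by rewrite -raddfD !algquot_mulE mulrDr raddfD.
Qed.
Fact algquot_1_neq0 : algproj 1 != 0.
Proof. by apply/eqP => /algproj0P. Qed.
HB.instance Definition _ := GRing.Zmodule_isNzRing.Build Q
  algquot_mulA algquot_mul1l algquot_mul1r algquot_mulDl algquot_mulDr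
  algquot_1_neq0.

Fact algproj_is_monoid_morphism : monoid_morphism algproj.
Proof. by split=> // u v; rewrite -algquot_mulE. Qed.
HB.instance Definition _ := GRing.isMonoidMorphism.Build R Q algproj
  algproj_is_monoid_morphism.

Fact algquot_scaleAl (c : k) (t u : Q) : c *: (t * u) = (c *: t) * u.
Proof.
elim/algprojW: t => t; elim/algprojW: u => u.
by rewrite -rmorphM -!linearZ -rmorphM scalerAl.
Qed.
HB.instance Definition _ := GRing.Lmodule_isLalgebra.Build k Q algquot_scaleAl.
Fact algquot_scaleAr (c : k) (t u : Q) : c *: (t * u) = t * (c *: u).
Proof.
elim/algprojW: t => t; elim/algprojW: u => u.
by rewrite -rmorphM -!linearZ -rmorphM scalerAr.
Qed.
HB.instance Definition _ := GRing.Lalgebra_isAlgebra.Build k Q algquot_scaleAr.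

End AlgQuotient.

(* Graded algebras A = A_0 + A_1 + ... (direct sum) with A_0 = k; homog i is *)
(* the homogeneous component A_i.                                            *)
HB.mixin Record Algebra_isConnGraded (k : fieldType) A of GRing.Algebra k A := {
  homog : nat -> A -> Prop;
  homog_0 : forall i, homog i 0;
  homog_lin : forall i c (a b : A),
    homog i a -> homog i b -> homog i (c *: a + b);
  homog_1 : homog 0 1;
  homog_M : forall i j (a b : A),
    homog i a -> homog j b -> homog (i + j) (a * b);
  homog_full : forall a : A, span (fun b => exists i, homog i b) a;
  homog_direct : forall N (h : nat -> A), (forall i, homog i (h i)) ->
    \sum_(i < N) h i = 0 -> forall i, (i < N)%N -> h i = 0;
  homog_const : forall a : A, homog 0 a -> exists c : k, a = c%:A
}.

#[short(type="connGradedAlgType")]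
HB.structure Definition ConnGraded (k : fieldType) :=
  {A of GRing.Algebra k A & Algebra_isConnGraded k A}.

Definition graded_iso (k : fieldType) (A B : connGradedAlgType k)
    (s : {lrmorphism A -> B}) : Prop :=
  bijective s /\ forall i a, homog i (s a) <-> homog i a.

Section FreeAlgebra.
Variables (k : fieldType) (Z : finType).

Definition freealg := {malg k[{fmonom Z}]}.
HB.instance Definition _ := GRing.Lalgebra.on freealg.

Definition freegen (z : Z) : freealg := << fmu z >>.

Lemma malgU_scale (K : choiceType) c (w : K) :
  << c *g w >> = c *: << w >> :> {malg k[K]}.
Proof. by apply/malgP => w'; rewrite mcoeffZ !mcoeffU mulrnAr mulr1. Qed.

Lemma malg_span (K : choiceType) (u : {malg k[K]}) :
  span (fun v => exists w, v = << w >>) u.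
Proof.
rewrite [u]monalgE; apply: span_sum => w _.
by rewrite malgU_scale; apply/spanZ/span_mem; exists w.
Qed.

Lemma malgMU (w1 w2 : {fmonom Z}) :
  << w1 >> * << w2 >> = << mmul w1 w2 >> :> freealg.
Proof. by rewrite [LHS]fgmulUU mulr1. Qed.

Fact freealg_scaleAr (c : k) (u v : freealg) : c *: (u * v) = u * (c *: v).
Proof.
rewrite (malgMEw (fsubset_refl _) (msuppZ_le c v)) malgME !scaler_sumr.
apply: eq_bigr => w1 _; rewrite scaler_sumr; apply: eq_bigr => w2 _.
by rewrite malgU_scale mcoeffZ mulrCA [RHS]malgU_scale scalerA.
Qed.
HB.instance Definition _ := GRing.Lalgebra_isAlgebra.Build k freealg
  freealg_scaleAr.

End FreeAlgebra.

Section Words.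
Variables (k : fieldType) (R : algType k) (Z : finType) (X : Z -> R).

Definition wordspan (i : nat) : R -> Prop :=
  span (fun a => exists w : seq Z, size w = i /\ a = \prod_(z <- w) X z).

Lemma wordspan_M i j (a b : R) :
  wordspan i a -> wordspan j b -> wordspan (i + j) (a * b).
Proof.
move=> + Hb; move: a; apply: span_min => [|c a a' Ha Ha'|_ [w [<- ->]]].
- by rewrite mul0r; exact: span_0.
- by rewrite mulrDl -scalerAl; exact: spanZD.
move: b Hb; apply: span_min => [|c b b' Hb Hb'|_ [w' [<- ->]]].
- by rewrite mulr0; exact: span_0.
- by rewrite mulrDr -scalerAr; exact: spanZD.
by apply: span_mem; exists (w ++ w'); rewrite size_cat big_cat.
Qed.

Lemma wordspan_1 : wordspan 0 1.
Proof. by apply: span_mem; exists [::]; rewrite big_nil. Qed.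

Lemma wordspan_const (a : R) : wordspan 0 a -> exists c : k, a = c%:A.
Proof.
move: a; apply: span_min => [|c _ _ [d ->] [e ->]|_ [w [/size0nil -> ->]]].
- by exists 0; rewrite scale0r.
- by exists (c * d + e); rewrite scalerDl scalerA.
- by exists 1; rewrite big_nil scale1r.
Qed.

Variable r : Z * Z -> Z * Z.

(* The relations xy = y'x' for r(x, y) = (y', x'). *)
Definition YBrel (u : R) : Prop :=
  exists x y : Z, u = X x * X y - X (r (x, y)).1 * X (r (x, y)).2.

Lemma YBrel_vanish (e : R -> k) :
    e 0 = 0 -> {morph e : u v / u + v} -> {morph e : u v / u - v} ->
    {morph e : u v / u * v} -> (forall c u, e (c *: u) = c * e u) ->
    (forall z, e (X z) = 0) ->
  forall u, ideal YBrel u -> e u = 0.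
Proof.
move=> e0 eD eB eM eZ eX.
apply: span_min => // [c u v eu ev|_ [a [_ [b [[x [y ->]] ->]]]]].
  by rewrite eD eZ eu ev mulr0 addr0.
by rewrite !eM eB !eM !eX !mul0r subrr mulr0 mul0r.
Qed.

Lemma YBrel_ideal_span (W : R -> Prop) : (forall a, span W a) ->
  forall u, ideal YBrel u -> span (fun v => exists a s b,
    [/\ W a, YBrel s, W b & v = a * s * b]) u.
Proof.
move=> Wfull; apply: span_min => [|c u v Su Sv|_ [a [s [b [Ss ->]]]]].
- exact: span_0.
- exact: spanZD.
elim: (Wfull a) => [|c a1 a2 Wa1 _ IH]; first by rewrite !mul0r; exact: span_0.
rewrite !mulrDl -!scalerAl; apply: spanZD => // {IH}.
elim: (Wfull b) => [|d b1 b2 Wb1 _ IH]; first by rewrite mulr0; exact: span_0.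
rewrite mulrDr -scalerAr; apply: spanZD => //.
by apply: span_mem; exists a1, s, b1.
Qed.

(* A linear map acting on each word as the identity or as zero, according to *)
(* the length of the word only, preserves the ideal of relations.            *)
Lemma YBrel_hpart (h : {linear R -> R}) (d : nat -> bool) :
    (forall w, h (\prod_(z <- w) X z) =
       if d (size w) then \prod_(z <- w) X z else 0) ->
    (forall a, span (fun b => exists w, b = \prod_(z <- w) X z) a) ->
  forall u, ideal YBrel u -> ideal YBrel (h u).
Proof.
move=> hw Wfull u /(YBrel_ideal_span Wfull).
move: u; apply: span_map => _ [_ [s [_ [[w1 ->] Ss [w2 ->] ->]]]].
have [x [y sE]] := Ss.
have wE x' y' : \prod_(z <- w1) X z * (X x' * X y') * \prod_(z <- w2) X z
    = \prod_(z <- w1 ++ [:: x'; y'] ++ w2) X z.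
  by rewrite !big_cat /= !big_cons big_nil mulr1 !mulrA.
have -> : h (\prod_(z <- w1) X z * s * \prod_(z <- w2) X z) =
    if d (size w1 + (2 + size w2))
    then \prod_(z <- w1) X z * s * \prod_(z <- w2) X z else 0.
  rewrite sE mulrBr mulrBl linearB /= !wE !hw !size_cat.
  by case: ifP => // _; rewrite subrr.
case: ifP => _; last exact: span_0.
by apply/idealMr/idealMl/ideal_mem.
Qed.

End Words.

Section FreeWords.
Variables (k : fieldType) (Z : finType).
Local Notation F := (freealg k Z).
Local Notation X := (@freegen k Z).

Lemma freewordE (w : {fmonom Z}) : << w >> = \prod_(z <- w) X z :> F.
Proof.
case: w => w /=; elim: w => [|z w IH]; first by rewrite big_nil -fmoneE.
rewrite big_cons -IH; transitivity (<< mmul (fmu z) (FMonom w) >> : F).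
  by congr (mkmalgU _ 1); rewrite -[RHS]fmK fmM fmU.
exact/esym/malgMU.
Qed.

Lemma freeword_span (u : F) :
  span (fun v => exists w, v = \prod_(z <- w) X z) u.
Proof.
apply: (span_map (f := idfun)) (malg_span u) => _ [w ->].
by apply: span_mem; exists w; apply: freewordE.
Qed.

Definition hpart (i : nat) (u : F) : F :=
  [malg w in msupp u => if size (w : {fmonom Z}) == i then u@_w else 0].

Fact mcoeff_hpart i u w : (hpart i u)@_w = if size w == i then u@_w else 0.
Proof. by rewrite mcoeffE; case: msuppP => //; rewrite if_same. Qed.

Fact hpart_is_linear i : linear (hpart i).
Proof.
move=> c u v; apply/malgP => w.
rewrite mcoeffD mcoeffZ !mcoeff_hpart mcoeffD mcoeffZ.
by case: ifP => // _; rewrite mulr0 addr0.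
Qed.
HB.instance Definition _ i :=
  GRing.isLinear.Build k F F *:%R (hpart i) (hpart_is_linear i).

Fact hpart_word i (w : seq Z) :
  hpart i (\prod_(z <- w) X z) = if size w == i then \prod_(z <- w) X z else 0.
Proof.
rewrite -(freewordE (FMonom w)); apply/malgP => w'.
rewrite mcoeff_hpart [RHS](fun_if (mcoeff w')) mcoeffU1 mcoeff0.
by case: (eqVneq (FMonom w) w') => [<-|_]; rewrite /= ?if_same.
Qed.

Variable r : Z * Z -> Z * Z.

Fact YBrel_proper : ~ ideal (YBrel X r) 1.
Proof.
move=> /(@YBrel_vanish k F Z X r (@mcoeff {fmonom Z} k mone)) e0.
suff : (1 : F)@_(mone) = 0 by move/eqP; rewrite mcoeff1 eqxx oner_eq0.
apply: e0.
- exact: mcoeff0.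
- exact: mcoeffD.
- exact: mcoeffB.
- exact: (rmorphM (@mcoeff {fmonom Z} k mone)).
- by move=> c u; apply: mcoeffZ.
- by move=> z; rewrite mcoeffU1 fm1_eq1.
Qed.

End FreeWords.

Section YangBaxterAlgebra.
Variables (k : fieldType) (Z : finType) (r : Z * Z -> Z * Z).
Local Notation F := (freealg k Z).
Local Notation X := (@freegen k Z).

Lemma hpart_wordspan i j u :
  wordspan X i u -> hpart j u = if i == j then u else 0.
Proof.
move: u; apply: span_min => [|c u v Hu Hv|_ [w [<- ->]]].
- by rewrite linear0 if_same.
- by rewrite (linearP (hpart j)) /= Hu Hv; case: ifP; rewrite ?scaler0 ?addr0.
- by rewrite hpart_word.
Qed.

Local Notation YBalg := (algquot (@YBrel_proper k Z r)).
Local Notation YBproj := (algproj (@YBrel_proper k Z r)).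

Definition YBgen (z : Z) : YBalg := YBproj (X z).

Definition YBhomog : nat -> YBalg -> Prop := wordspan YBgen.

Fact YBhomog_0 i : YBhomog i 0. Proof. exact: span_0. Qed.

Fact YBhomog_lin i c (a b : YBalg) :
  YBhomog i a -> YBhomog i b -> YBhomog i (c *: a + b).
Proof. exact: spanZD. Qed.

Fact YBproj_word (w : seq Z) :
  YBproj (\prod_(z <- w) X z) = \prod_(z <- w) YBgen z.
Proof. exact: rmorph_prod. Qed.

Fact YBhomog_full (a : YBalg) : span (fun b => exists i, YBhomog i b) a.
Proof.
elim/algprojW: a => u; apply: (span_map (f := YBproj)) (freeword_span u).
move=> _ [w ->]; apply: span_mem; exists (size w); apply: span_mem; exists w.
by split=> //; exact: YBproj_word.
Qed.

Fact YBhomog_lift i a : YBhomog i a -> exists u, wordspan X i u /\ YBproj u = a.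
Proof.
move: a; apply: span_min => [|c _ _ [u [Hu <-]] [v [Hv <-]]|_ [w [<- ->]]].
- by exists 0; split; [exact: span_0 | exact: raddf0].
- by exists (c *: u + v); split; [exact: spanZD | exact: linearP].
- exists (\prod_(z <- w) X z); split; last exact: YBproj_word.
  by apply: span_mem; exists w.
Qed.

Fact YBhomog_direct N (h : nat -> YBalg) : (forall i, YBhomog i (h i)) ->
  \sum_(i < N) h i = 0 -> forall i, (i < N)%N -> h i = 0.
Proof.
move=> Hh h0 j jN; have [u uh] := choice (fun i => YBhomog_lift (Hh i)).
have : ideal (YBrel X r) (hpart j (\sum_(i < N) u i)).
  apply: (YBrel_hpart (d := fun n => n == j)) => [w|a|].
  - exact: hpart_word.
  - exact: freeword_span.
  apply/(algproj0P (@YBrel_proper k Z r)).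
  transitivity (YBproj (\sum_(i < N) u i)) => //.
  rewrite raddf_sum -[RHS]h0; apply: eq_bigr => i _.
  by have [] := uh i.
rewrite raddf_sum (bigD1 (Ordinal jN)) //= big1 ?addr0 => [|i ij].
  rewrite (hpart_wordspan _ (uh j).1) eqxx.
  move/(algproj0P (@YBrel_proper k Z r)).
  by rewrite -[h j](uh j).2.
by rewrite (hpart_wordspan _ (uh i).1) (negPf (ij : (i : nat) != j)).
Qed.

HB.instance Definition _ := Algebra_isConnGraded.Build k YBalg
  YBhomog_0 YBhomog_lin (wordspan_1 YBgen) (@wordspan_M _ _ _ YBgen)
  YBhomog_full YBhomog_direct (@wordspan_const _ _ _ YBgen).

End YangBaxterAlgebra.

Notation YBalg k r := (algquot (@YBrel_proper k _ r)).

Definition perm_sol (Z : finType) (g : {perm Z}) : Z * Z -> Z * Z :=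
  fun xy => (g xy.2, xy.2).

(* The tensor product over k: the free vector space on V x W modulo the      *)
(* bilinearity relations.                                                    *)
Section TensorSpace.
Variables (k : fieldType) (V W : lmodType k).
Local Notation F := {malg k[(V * W)%type]}.

Inductive bilin_rel : F -> Prop :=
| bilin_rell c v v' w :
    bilin_rel (<< (c *: v + v', w) >> - (c *: << (v, w) >> + << (v', w) >>))
| bilin_relr c v w w' :
    bilin_rel (<< (v, c *: w + w') >> - (c *: << (v, w) >> + << (v, w') >>)).

Definition tensor := lmodquot bilin_rel.
Local Notation L := (lmodquot bilin_rel).
HB.instance Definition _ := Choice.on tensor.
Definition tensor_add : tensor -> tensor -> tensor := @Algebra.add L.
Definition tensor_opp : tensor -> tensor := @Algebra.opp L.
Definition tensor_zero : tensor := 0 : L.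
Definition tensor_scale : k -> tensor -> tensor := @GRing.scale k L.
Fact tensor_addA : associative tensor_add. Proof. exact: (@addrA L). Qed.
Fact tensor_addC : commutative tensor_add. Proof. exact: (@addrC L). Qed.
Fact tensor_add0 : left_id tensor_zero tensor_add.
Proof. exact: (@add0r L). Qed.
Fact tensor_addN : left_inverse tensor_zero tensor_opp tensor_add.
Proof. exact: (@addNr L). Qed.
HB.instance Definition _ :=
  GRing.isZmodule.Build tensor tensor_addA tensor_addC tensor_add0 tensor_addN.
Fact tensor_scalerA c d t :
  tensor_scale c (tensor_scale d t) = tensor_scale (c * d) t.
Proof. exact: (@scalerA k L). Qed.
Fact tensor_scale1r : left_id 1 tensor_scale. Proof. exact: (@scale1r k L). Qed.
Fact tensor_scalerDr : right_distributive tensor_scale +%R.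
Proof. exact: (@scalerDr k L). Qed.
Fact tensor_scalerDl t : {morph tensor_scale^~ t : c d / c + d}.
Proof. by move=> c d; exact: (@scalerDl k L). Qed.
HB.instance Definition _ := GRing.Zmodule_isLmodule.Build k tensor
  tensor_scalerA tensor_scale1r tensor_scalerDr tensor_scalerDl.

Definition tproj : F -> tensor := @proj k F bilin_rel.
Fact tproj_is_linear : linear tproj. Proof. exact: proj_is_linear. Qed.
HB.instance Definition _ :=
  GRing.isLinear.Build k F tensor *:%R tproj tproj_is_linear.

Fact tprojW (P : tensor -> Prop) : (forall u, P (tproj u)) -> forall t, P t.
Proof. exact: projW. Qed.

Definition tens : V -> W -> tensor :=
  locked_with quot_key (fun v w => tproj << (v, w) >>).
Lemma tensE v w : tens v w = tproj << (v, w) >>.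
Proof. by rewrite /tens locked_withE. Qed.

Lemma tens_linearl w : linear (tens^~ w).
Proof.
move=> c v v'; rewrite !tensE -linearP; apply/projP.
by apply: span_mem; exact: bilin_rell.
Qed.

Lemma tens_linearr v : linear (tens v).
Proof.
move=> c w w'; rewrite !tensE -linearP; apply/projP.
by apply: span_mem; exact: bilin_relr.
Qed.

Lemma tens_span (t : tensor) : span (fun s => exists v w, s = tens v w) t.
Proof.
elim/tprojW: t => u; apply: (span_map (f := tproj)) (malg_span u).
by move=> _ [[v w] ->]; apply: span_mem; exists v, w; rewrite tensE.
Qed.

Section Lift.
Variables (U : lmodType k) (f : V -> W -> U).
Hypothesis f_linearl : forall w, linear (f^~ w).
Hypothesis f_linearr : forall v, linear (f v).

Let flift (u : F) : U := \sum_(p <- msupp u) u@_p *: f p.1 p.2.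

Fact fliftEw (d : {fset (V * W)%type}) u :
  (msupp u `<=` d)%fset -> flift u = \sum_(p <- d) u@_p *: f p.1 p.2.
Proof.
move=> le; rewrite [LHS](big_fset_incl _ le) => //= x xd /mcoeff_outdom ->.
by rewrite scale0r.
Qed.

Fact flift_is_linear : linear flift.
Proof.
move=> c u v; pose d := (msupp u `|` msupp v)%fset.
have du : (msupp u `<=` d)%fset by exact: fsubsetUl.
have dv : (msupp v `<=` d)%fset by exact: fsubsetUr.
have dcu : (msupp (c *: u) `<=` d)%fset.
  by exact: fsubset_trans (msuppZ_le _ _) du.
have duv : (msupp (c *: u + v) `<=` d)%fset.
  by apply: fsubset_trans (msuppD_le _ _) _; rewrite fsubUset dcu.
rewrite (fliftEw du) (fliftEw dv) (fliftEw duv) scaler_sumr -big_split /=.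
by apply: eq_bigr => p _; rewrite mcoeffD mcoeffZ scalerDl scalerA.
Qed.
HB.instance Definition _ :=
  GRing.isLinear.Build k F U *:%R flift flift_is_linear.

Fact fliftU p : flift << p >> = f p.1 p.2.
Proof. by rewrite /flift msuppU oner_eq0 big_seq_fset1 mcoeffUU scale1r. Qed.

Definition tensor_lift : tensor -> U :=
  locked_with quot_key (fun t => flift (repr t)).

Fact flift_vanish u : span bilin_rel u -> flift u = 0.
Proof.
move: u; apply: span_min => [|c u v u0 v0|_ [c v v' w|c v w w']].
- exact: linear0.
- by rewrite linearP /= u0 v0 scaler0 addr0.
- by rewrite linearB linearP /= !fliftU /= f_linearl subrr.
- by rewrite linearB linearP /= !fliftU /= f_linearr subrr.
Qed.

Fact tensor_lift_proj u : tensor_lift (tproj u) = flift u.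
Proof.
rewrite /tensor_lift locked_withE.
apply/eqP; rewrite -subr_eq0 -linearB; apply/eqP/flift_vanish/projP.
exact: projK.
Qed.

Lemma tensor_liftE v w : tensor_lift (tens v w) = f v w.
Proof. by rewrite tensE tensor_lift_proj fliftU. Qed.

Lemma tensor_lift_linear : linear tensor_lift.
Proof.
move=> c; elim/tprojW => u; elim/tprojW => v.
by rewrite -(linearP tproj) !tensor_lift_proj linearP.
Qed.

End Lift.
End TensorSpace.

(* A linear form on A with value 1 at 1; it witnesses 1 tensor 1 <> 0.       *)
Lemma unit_linear_form (k : fieldType) (A : algType k) :
  exists e : A -> k, (forall c a b, e (c *: a + b) = c * e a + e b) /\ e 1 = 1.
Proof.
pose P (S : set A) :=
  (forall c a b, S a -> S b -> S (c *: a + b)) /\ ~ S 1.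
have [F FP tot|M [[Mlin M1] Mmax]] := @Zorn_bigcup A P.
  split=> [c a b [S FS Sa] [T FT Tb]|[S FS]]; last by have [] := FP _ FS.
  have [ST|TS] := tot _ _ FS FT.
    by exists T => //; have [lin _] := FP _ FT; apply: lin => //; exact: ST.
  by exists S => //; have [lin _] := FP _ FS; apply: lin => //; exact: TS.
have M0 : M 0.
  apply: contrapT => nM0; apply: (Mmax [set 0]%classic).
    split=> [x Mx|]; last by move/(_ 0 erefl).
    by case: nM0; rewrite -[0](addNr x) -scaleN1r; exact: Mlin.
  split=> [c a b -> ->|/eqP]; first by rewrite /= scaler0 addr0.
  by rewrite oner_eq0.
have MZ c a : M a -> M (c *: a).
  by move=> Ma; rewrite -[_ *: _]addr0; exact: Mlin.
have full a : exists c, M (a - c%:A).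
  have [Ma|nMa] := pselect (M a); first by exists 0; rewrite scale0r subr0.
  pose N := [set x | exists c, M (x - c *: a)]%classic.
  have [c Mc] : N 1.
    apply: contrapT => N1; apply: (Mmax N).
      split=> [x Mx|]; first by exists 0; rewrite scale0r subr0.
      by move=> NM; apply/nMa/NM; exists 1; rewrite scale1r subrr.
    split=> // d x y [e Me] [e' Me']; exists (d * e + e').
    rewrite (_ : _ - _ = d *: (x - e *: a) + (y - e' *: a)); first exact: Mlin.
    by rewrite scalerBr scalerDl scalerA opprD addrACA.
  have c0 : c != 0.
    by apply: contra_notN M1 => /eqP c0; move: Mc; rewrite c0 scale0r subr0.
  exists c^-1; rewrite -[a](scale1r a) -{1}(mulVf c0) -scalerA -scalerBr.
  by apply: (MZ); rewrite -opprB -scaleN1r; exact: MZ.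
have uniq c d a : M (a - c%:A) -> M (a - d%:A) -> c = d.
  move=> Mc Md; apply/eqP; rewrite -subr_eq0; apply: contra_notT M1 => cd.
  rewrite -[1](scale1r _) -(mulVf cd) -scalerA; apply: (MZ).
  rewrite (_ : _ *: _ = -1 *: (a - c%:A) + (a - d%:A)); first exact: Mlin.
  by rewrite scaleN1r opprB addrA subrK scalerBl.
have [e eP] := choice full; exists e; split=> [c a b|].
- apply: (uniq _ _ _ (eP _)).
  rewrite (_ : _ - _ = c *: (a - (e a)%:A) + (b - (e b)%:A)); first exact: Mlin.
  by rewrite scalerBr scalerDl scalerA opprD addrACA.
- by apply: (uniq _ _ _ (eP _)); rewrite scale1r subrr.
Qed.

Lemma linear_fun0 (k : fieldType) (U V : lmodType k) (f : U -> V) :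
  linear f -> f 0 = 0.
Proof. by move=> /(_ (-1) 0 0); rewrite !scaleN1r addNr addNr. Qed.

Lemma linear_funZ (k : fieldType) (U V : lmodType k) (f : U -> V) c u :
  linear f -> f (c *: u) = c *: f u.
Proof. by move=> flin; rewrite -[c *: u]addr0 flin linear_fun0 // addr0. Qed.

Fact scale_exchange (k : fieldType) (V : lmodType k) (c d : k) (x y s t : V) :
  d *: (c *: x + y) + (c *: s + t) = c *: (d *: x + s) + (d *: y + t).
Proof. by rewrite !scalerDr !scalerA (mulrC c) addrACA. Qed.

Section TensorAlgebra.
Variables (k : fieldType) (A B : algType k).
Local Notation T := (tensor A B).
Implicit Types (a : A) (b : B) (t u v : T).

Lemma tensor_ind (P : T -> Prop) :
    (forall c a b t, P t -> P (c *: tens a b + t)) -> P 0 -> forall t, P t.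
Proof.
by move=> Pl P0 t; elim: (tens_span t) => // c _ {}t [a [b ->]] _; apply: Pl.
Qed.

Definition mul_pure a b : T -> T :=
  tensor_lift (fun a' b' => tens (a * a') (b * b')).

Fact mul_pure_linear a b : linear (mul_pure a b).
Proof.
apply: tensor_lift_linear => [b'|a'] c x y /=.
- by rewrite mulrDr -scalerAr tens_linearl.
- by rewrite mulrDr -scalerAr tens_linearr.
Qed.

Fact mul_pure0 a b : mul_pure a b 0 = 0.
Proof. exact: linear_fun0 (mul_pure_linear a b). Qed.

Fact mul_pureE a b a' b' :
  mul_pure a b (tens a' b') = tens (a * a') (b * b').
Proof.
apply: tensor_liftE => [b''|a''] c x y /=.
- by rewrite mulrDr -scalerAr tens_linearl.
- by rewrite mulrDr -scalerAr tens_linearr.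
Qed.

Fact mul_pure_linearl u b : linear (fun a => mul_pure a b u).
Proof.
move=> c a a' /=; elim/tensor_ind: u => [d x y t IH|]; last first.
  by rewrite !mul_pure0 scaler0 addr0.
rewrite !mul_pure_linear IH !mul_pureE mulrDl -scalerAl tens_linearl.
exact: scale_exchange.
Qed.

Fact mul_pure_linearr u a : linear (fun b => mul_pure a b u).
Proof.
move=> c b b' /=; elim/tensor_ind: u => [d x y t IH|]; last first.
  by rewrite !mul_pure0 scaler0 addr0.
rewrite !mul_pure_linear IH !mul_pureE mulrDl -scalerAl tens_linearr.
exact: scale_exchange.
Qed.

(* The multiplication with tens a b * tens a' b' = tens (aa') (bb'). *)
Definition tensor_mul (t u : T) : T :=
  tensor_lift (fun a b => mul_pure a b u) t.

Fact tensor_mul_linearl u : linear (tensor_mul^~ u).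
Proof.
by apply: tensor_lift_linear => [b|a];
  [exact: mul_pure_linearl | exact: mul_pure_linearr].
Qed.

Fact tensor_mul_purel a b u : tensor_mul (tens a b) u = mul_pure a b u.
Proof.
by apply: (tensor_liftE (f := fun a b => mul_pure a b u)) => [b'|a'];
  [exact: mul_pure_linearl | exact: mul_pure_linearr].
Qed.

Fact tensor_mul0l u : tensor_mul 0 u = 0.
Proof. exact: (linear_fun0 (tensor_mul_linearl u)). Qed.

Fact tensor_mulDl : left_distributive tensor_mul +%R.
Proof.
by move=> t t' u; have := tensor_mul_linearl u 1 t t'; rewrite !scale1r.
Qed.

Fact tensor_scaleAl c t u : c *: tensor_mul t u = tensor_mul (c *: t) u.
Proof.
by have /= := tensor_mul_linearl u c t 0; rewrite tensor_mul0l !addr0.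
Qed.

Fact tensor_mul_linearr t : linear (tensor_mul t).
Proof.
move=> c u v; elim/tensor_ind: t => [d a b t IH|]; last first.
  by rewrite !tensor_mul0l scaler0 addr0.
rewrite !tensor_mulDl IH -!tensor_scaleAl !tensor_mul_purel mul_pure_linear.
exact: scale_exchange.
Qed.

Fact tensor_mul0r t : tensor_mul t 0 = 0.
Proof. exact: linear_fun0 (tensor_mul_linearr t). Qed.

Fact tensor_mulDr : right_distributive tensor_mul +%R.
Proof.
by move=> t u v; have := tensor_mul_linearr t 1 u v; rewrite !scale1r.
Qed.

Fact tensor_scaleAr c t u : c *: tensor_mul t u = tensor_mul t (c *: u).
Proof.
by have /= := tensor_mul_linearr t c u 0; rewrite tensor_mul0r !addr0.
Qed.

Fact tensor_mul_pure a b a' b' :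
  tensor_mul (tens a b) (tens a' b') = tens (a * a') (b * b').
Proof. by rewrite tensor_mul_purel mul_pureE. Qed.

Fact tensor_mulA : associative tensor_mul.
Proof.
move=> t u v; elim/tensor_ind: t => [c a b t IH|]; last first.
  by rewrite !tensor_mul0l.
rewrite !tensor_mulDl IH -!tensor_scaleAl; congr (_ *: _ + _).
elim/tensor_ind: u {IH} => [d a' b' u IHu|].
  rewrite !(tensor_mulDl, tensor_mulDr) IHu -!(tensor_scaleAl, tensor_scaleAr).
  congr (_ *: _ + _); elim/tensor_ind: v {IHu} => [e x y v IHv|].
    rewrite !tensor_mulDr IHv -!tensor_scaleAr !tensor_mul_pure.
    by rewrite !mulrA.
  by rewrite !tensor_mul0r.
by rewrite tensor_mul0l tensor_mul0r tensor_mul0l.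
Qed.

Fact tensor_mul1l : left_id (tens 1 1) tensor_mul.
Proof.
elim/tensor_ind => [c a b t IH|]; last exact: tensor_mul0r.
by rewrite tensor_mulDr IH -tensor_scaleAr tensor_mul_pure !mul1r.
Qed.

Fact tensor_mul1r : right_id (tens 1 1) tensor_mul.
Proof.
elim/tensor_ind => [c a b t IH|]; last exact: tensor_mul0l.
by rewrite tensor_mulDl IH -tensor_scaleAl tensor_mul_pure !mulr1.
Qed.

Fact tensor_1_neq0 : (tens 1 1 : T) != 0.
Proof.
have [e [elin e1]] := unit_linear_form A.
have [f [flin f1]] := unit_linear_form B.
pose g a b : k^o := e a * f b.
have gl b : linear (g^~ b).
  by move=> c x y; rewrite /g elin mulrDl -mulrA.
have gr a : linear (g a).
  by move=> c x y; rewrite /g flin mulrDr mulrCA.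
apply/eqP => t0; have := tensor_liftE gl gr 1 1; rewrite t0 /g e1 f1 mulr1.
rewrite (linear_fun0 (tensor_lift_linear gl gr)) => /eqP.
by rewrite eq_sym oner_eq0.
Qed.

HB.instance Definition _ := GRing.Zmodule_isNzRing.Build T
  tensor_mulA tensor_mul1l tensor_mul1r tensor_mulDl tensor_mulDr tensor_1_neq0.
HB.instance Definition _ := GRing.Lmodule_isLalgebra.Build k T tensor_scaleAl.
HB.instance Definition _ := GRing.Lalgebra_isAlgebra.Build k T tensor_scaleAr.

Lemma tens_mul a b a' b' :
  (tens a b : T) * tens a' b' = tens (a * a') (b * b').
Proof. exact: tensor_mul_pure. Qed.

Lemma tens_1 : tens 1 1 = 1 :> T.
Proof. by []. Qed.

End TensorAlgebra.

Section HomogeneousComponent.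
Variables (k : fieldType) (A : connGradedAlgType k).
Implicit Types (a b : A) (h : nat -> A).

Definition is_decomp a h N :=
  [/\ forall i, homog i (h i), forall i, (N <= i)%N -> h i = 0
    & a = \sum_(i < N) h i].

Lemma homogZ i c a : homog i a -> homog i (c *: a).
Proof. by move=> Ha; rewrite -[_ *: _]addr0; apply/homog_lin/homog_0. Qed.

Lemma decomp_widen a h N M :
  is_decomp a h N -> (N <= M)%N -> is_decomp a h M.
Proof.
case=> hom h0 -> NM; split=> // [i Mi|]; first exact/h0/(leq_trans NM).
rewrite -(subnKC NM) big_split_ord /= [X in _ + X]big1 ?addr0 // => i _.
by rewrite h0 // leq_addr.
Qed.

Lemma decomp_lin c a h N a' h' N' : is_decomp a h N -> is_decomp a' h' N' ->
  is_decomp (c *: a + a') (fun i => c *: h i + h' i) (maxn N N').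
Proof.
move=> /decomp_widen/(_ (leq_maxl N N'))[hom h0 ->].
move=> /decomp_widen/(_ (leq_maxr N N'))[hom' h0' ->]; split=> [i|i Mi|].
- exact: homog_lin.
- by rewrite h0 // h0' // scaler0 addr0.
- by rewrite scaler_sumr -big_split.
Qed.

Lemma decomp_homog j a :
  homog j a -> is_decomp a (fun i => if i == j then a else 0) j.+1.
Proof.
move=> ja; split=> [i|i ji|].
- by case: eqP => [->|_] //; exact: homog_0.
- by rewrite gtn_eqF.
- rewrite big_ord_recr /= eqxx big1 ?add0r // => i _.
  by rewrite ltn_eqF.
Qed.

Lemma decomp_ex a : exists h, exists N, is_decomp a h N.
Proof.
elim: (homog_full a) => [|c s b [j jb] _ [h [N hb]]].
  by exists (fun=> 0), 0; split=> [i||] //; [exact: homog_0 | rewrite big_ord0].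
by eexists; eexists; exact: decomp_lin (decomp_homog jb) hb.
Qed.

Lemma decomp_uniq a h N h' N' :
  is_decomp a h N -> is_decomp a h' N' -> h =1 h'.
Proof.
move=> ah ah' i.
have [hom h0 aE] := decomp_lin (-1) ah ah'.
have [ltiM|leMi] := ltnP i (maxn N N'); last first.
  by have /eqP := h0 _ leMi; rewrite scaleN1r addrC subr_eq0 => /eqP.
have sum0 : \sum_(i < maxn N N') (-1 *: h i + h' i) = 0.
  by rewrite -aE scaleN1r addNr.
have /eqP := homog_direct _ _ hom sum0 _ ltiM.
by rewrite scaleN1r addrC subr_eq0 => /eqP.
Qed.

Definition hcomp (i : nat) a : A := sval (cid (decomp_ex a)) i.

Lemma hcompP a : exists N, is_decomp a (hcomp^~ a) N.
Proof. by rewrite /hcomp; case: cid. Qed.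

Lemma hcomp_linear i : linear (hcomp i).
Proof.
move=> c a b; have [N aN] := hcompP a; have [M bM] := hcompP b.
have [P abP] := hcompP (c *: a + b).
exact: decomp_uniq abP (decomp_lin c aN bM) i.
Qed.

Lemma hcomp_homog i j a : homog j a -> hcomp i a = if i == j then a else 0.
Proof.
move=> ja; have [N aN] := hcompP a.
exact: decomp_uniq aN (decomp_homog ja) i.
Qed.

End HomogeneousComponent.

(* As k is a field, A_i (x) B_i is identified with its image in A (x) B.     *)
Section SegreProduct.
Variables (k : fieldType) (A B : connGradedAlgType k).
Local Notation T := (tensor A B).

Definition segre_homog (i : nat) : T -> Prop :=
  span (fun t => exists a b, [/\ homog i a, homog i b & t = tens a b]).

Definition segre_pred : {pred T} :=
  span_pred (fun t => exists i, segre_homog i t).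

Lemma segre_predP t :
  reflect (span (fun t => exists i, segre_homog i t) t) (t \in segre_pred).
Proof. exact: span_predP. Qed.

Lemma segre_homog_lin i c (s t : T) :
  segre_homog i s -> segre_homog i t -> segre_homog i (c *: s + t).
Proof. exact: spanZD. Qed.

Lemma segre_homog_1 : segre_homog 0 (1 : T).
Proof. by apply: span_mem; exists 1, 1; split=> //; exact: homog_1. Qed.

Lemma segre_homog_M i j (s t : T) :
  segre_homog i s -> segre_homog j t -> segre_homog (i + j) (s * t).
Proof.
move=> + jt; move: s; apply: span_min => [|c s s' IH IH'|_ [a [b [ia ib ->]]]].
- by rewrite mul0r; exact: span_0.
- by rewrite mulrDl -scalerAl; exact: spanZD.
move: t jt; apply: span_min => [|c t t' IH IH'|_ [a' [b' [ja jb ->]]]].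
- by rewrite mulr0; exact: span_0.
- by rewrite mulrDr -scalerAr; exact: spanZD.
rewrite tens_mul; apply: span_mem; exists (a * a'), (b * b').
by split=> //; exact: homog_M.
Qed.

Lemma segre_homog_pred i t : segre_homog i t -> t \in segre_pred.
Proof. by move=> it; apply/segre_predP/span_mem; exists i. Qed.

Fact segre_subalg_closed : subalg_closed segre_pred.
Proof.
split=> [|c s t|s t].
- exact: segre_homog_pred segre_homog_1.
- by move=> /segre_predP Ss /segre_predP St; apply/segre_predP/spanZD.
move=> + /segre_predP St => /segre_predP Ss; apply/segre_predP.
move: s Ss; apply: span_min => [|c s s' IH IH'|s [i is_]].
- by rewrite mul0r; exact: span_0.
- by rewrite mulrDl -scalerAl; exact: spanZD.
move: t St; apply: span_min => [|c t t' IH IH'|t [j jt]].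
- by rewrite mulr0; exact: span_0.
- by rewrite mulrDr -scalerAr; exact: spanZD.
by apply: span_mem; exists (i + j)%N; exact: segre_homog_M.
Qed.

Definition segre := {t : T | t \in segre_pred}.
HB.instance Definition _ := SubChoice.on segre.
HB.instance Definition _ :=
  GRing.SubChoice_isSubAlgebra.Build k T segre_pred segre segre_subalg_closed.

Definition segre_comp (i : nat) (u : segre) : Prop := segre_homog i (val u).

Fact segre_comp_0 i : segre_comp i 0. Proof. exact: span_0. Qed.
Fact segre_comp_lin i c (u v : segre) :
  segre_comp i u -> segre_comp i v -> segre_comp i (c *: u + v).
Proof. exact: spanZD. Qed.
Fact segre_comp_1 : segre_comp 0 1. Proof. exact: segre_homog_1. Qed.
Fact segre_comp_M i j (u v : segre) :
  segre_comp i u -> segre_comp j v -> segre_comp (i + j) (u * v).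
Proof. exact: segre_homog_M. Qed.

Fact segre_comp_full (u : segre) : span (fun v => exists i, segre_comp i v) u.
Proof.
pose mk t (tS : t \in segre_pred) : segre := exist _ t tS.
case: u => t tS; have /segre_predP St := tS.
elim: St tS => [|c s t' [i is_] St' IH] tS; rewrite -/(mk _ tS).
  have -> : mk _ tS = 0 by exact: val_inj.
  exact: span_0.
have s_in := segre_homog_pred is_; have /segre_predP t'_in := St'.
have -> : mk _ tS = c *: mk _ s_in + mk _ t'_in by exact: val_inj.
by apply: span_lin; [exists i | exact: IH].
Qed.

Definition hcomp2 (i : nat) : T -> T :=
  tensor_lift (fun (a : A) (b : B) => tens (hcomp i a) (hcomp i b)).

Let hcomp2_linearl i (b : B) :
  linear (fun a : A => tens (hcomp i a) (hcomp i b)).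
Proof. by move=> c a a' /=; rewrite hcomp_linear tens_linearl. Qed.
Let hcomp2_linearr i (a : A) :
  linear (fun b : B => tens (hcomp i a) (hcomp i b)).
Proof. by move=> c b b' /=; rewrite hcomp_linear tens_linearr. Qed.

Fact hcomp2_linear i : linear (hcomp2 i).
Proof. exact: tensor_lift_linear (hcomp2_linearl i) (hcomp2_linearr i). Qed.
HB.instance Definition _ i :=
  GRing.isLinear.Build k T T *:%R (hcomp2 i) (hcomp2_linear i).

Fact hcomp2_homog i j (t : T) :
  segre_homog j t -> hcomp2 i t = if i == j then t else 0.
Proof.
move: t; apply: span_min => [|c s t sE tE|_ [a [b [ja jb ->]]]].
- by rewrite raddf0 if_same.
- by rewrite hcomp2_linear sE tE; case: ifP; rewrite ?scaler0 ?addr0.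
rewrite /hcomp2 (tensor_liftE (hcomp2_linearl i) (hcomp2_linearr i)).
rewrite (hcomp_homog _ ja) (hcomp_homog _ jb); case: ifP => // _.
exact: linear_fun0 (tens_linearr 0).
Qed.

Fact segre_comp_direct N (h : nat -> segre) : (forall i, segre_comp i (h i)) ->
  \sum_(i < N) h i = 0 -> forall i, (i < N)%N -> h i = 0.
Proof.
move=> hom sum0 j jN; apply: val_inj.
have : hcomp2 j (val (\sum_(i < N) h i)) = 0 by rewrite sum0 raddf0.
rewrite !raddf_sum (bigD1 (Ordinal jN)) //= big1 ?addr0 => [|i ij].
  by rewrite (hcomp2_homog _ (hom j)) eqxx.
by rewrite (hcomp2_homog _ (hom i)) eq_sym (negPf (ij : (i : nat) != j)).
Qed.

Fact segre_comp_const (u : segre) : segre_comp 0 u -> exists c : k, u = c%:A.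
Proof.
suff: forall t : T, segre_homog 0 t -> exists c : k, t = c%:A.
  by move=> H u0; have [c cE] := H _ u0; exists c; exact: val_inj.
apply: span_min => [|c _ _ [d ->] [e ->]|_ [a [b [Ha Hb ->]]]].
- by exists 0; rewrite scale0r.
- by exists (c * d + e); rewrite scalerDl scalerA.
- have [[c ->] [d ->]] := (homog_const a Ha, homog_const b Hb).
  exists (c * d).
  rewrite (linear_funZ _ _ (tens_linearl _)) (linear_funZ _ _ (tens_linearr _)).
  by rewrite scalerA.
Qed.

HB.instance Definition _ := Algebra_isConnGraded.Build k segre
  segre_comp_0 segre_comp_lin segre_comp_1 segre_comp_M
  segre_comp_full segre_comp_direct segre_comp_const.

End SegreProduct.
Arguments segre_pred {k} A B _.

Section SegreMap.
Variables (k : fieldType) (m n : nat) (X Y Z : finType).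
Variables (rX : X * X -> X * X) (rY : Y * Y -> Y * Y) (rZ : Z * Z -> Z * Z).
Variables (x : 'I_m -> X) (y : 'I_n -> Y) (z : 'I_m -> 'I_n -> Z).

Definition is_segre_map
    (s : {lrmorphism YBalg k rZ -> tensor (YBalg k rX) (YBalg k rY)}) : Prop :=
  forall i a,
    s (YBgen k rZ (z i a)) = tens (YBgen k rX (x i)) (YBgen k rY (y a)).

End SegreMap.

(* Main.v *)
Require Import Defs.
From HB Require Import structures.
From mathcomp Require Import all_boot perm all_algebra.
From mathcomp Require Import boolp finmap monalg.

(** In the algebra of a permutation solution the relation x y = g(y) y says
    that the product x y does not depend on x: it is the same for every letter
    in the first place. Hence a word of length d >= 1 is determined, as an
    element of the algebra, by d and its last letter, and conversely the
    relations change neither of these. So each homogeneous component of degree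
    d >= 1 has a basis indexed by the letters. This basis is encoded by
    replacing every letter of a word by the last one ([shadow]); [perm_coord]
    says that the resulting coordinates are well defined and faithful.

    The Segre map exists because tens x_p y_q satisfies the relations of A_Z,
    these being the relations of A and of B in each factor. It sends a word in
    the letters z_{ia} to the tensor product of the two words read off from the
    indices ([segre_word]). Two words of equal length in the two alphabets are
    the same thing as one word in pairs of letters, so the image contains every
    A_i (x) B_i and nothing else ([segre_image], and degree by degree
    [segre_homog_image] and [segre_homog_preimage]).

    For injectivity, the coordinate of an element c of A_Z along a word v is
    read off from s c: it is the value of the linear form on the tensor product
    that multiplies the coordinates along the two projections of v
    ([segre_inj]). So s c = 0 forces all coordinates of c to vanish. *)

Set Implicit Arguments.
Unset Strict Implicit.
Unset Printing Implicit Defensive.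

Import GRing.Theory.
Local Open Scope ring_scope.

(** * Linear maps given on a basis or on a spanning set *)

Section LinearExtension.
Variables (k : fieldType) (K : choiceType) (V : lmodType k) (h : K -> V).

Definition malg_lift (u : {malg k[K]}) : V := \sum_(w <- msupp u) u@_w *: h w.

Lemma malg_liftEw (d : {fset K}) u :
  (msupp u `<=` d)%fset -> malg_lift u = \sum_(w <- d) u@_w *: h w.
Proof.
move=> le; rewrite [LHS](big_fset_incl _ le) // => w _ /mcoeff_outdom ->.
by rewrite scale0r.
Qed.

Fact malg_lift_is_linear : linear malg_lift.
Proof.
move=> c u v; pose d := (msupp u `|` msupp v)%fset.
have du : (msupp u `<=` d)%fset by exact: fsubsetUl.
have dv : (msupp v `<=` d)%fset by exact: fsubsetUr.
have duv : (msupp (c *: u + v) `<=` d)%fset.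
  apply: fsubset_trans (msuppD_le _ _) _; rewrite fsubUset dv andbT.
  exact: fsubset_trans (msuppZ_le _ _) du.
rewrite (malg_liftEw du) (malg_liftEw dv) (malg_liftEw duv) scaler_sumr.
rewrite -big_split /=; apply: eq_bigr => w _.
by rewrite mcoeffD mcoeffZ scalerDl scalerA.
Qed.
HB.instance Definition _ :=
  GRing.isLinear.Build k {malg k[K]} V *:%R malg_lift malg_lift_is_linear.

Lemma malg_liftU w : malg_lift << w >> = h w.
Proof.
by rewrite /malg_lift msuppU oner_eq0 big_seq_fset1 mcoeffUU scale1r.
Qed.

End LinearExtension.

(* The span of a predicate, as opposed to that of a sequence of vectors. *)
Local Notation span := Defs.span.

Lemma eq_on_span (k : fieldType) (U V : lmodType k) (S : U -> Prop)
    (f g : {linear U -> V}) :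
  (forall s, S s -> f s = g s) -> forall u, span S u -> f u = g u.
Proof.
move=> fg; apply: span_min => // [|c u v fu fv]; first by rewrite !linear0.
by rewrite !linearP fu fv.
Qed.

(** * Maps out of an algebra spanned by words *)

Section WordMaps.
Variables (k : fieldType) (R : algType k) (Z : finType) (X : Z -> R).
Local Notation word w := (\prod_(z <- w) X z).
Hypothesis word_span : forall a, span (fun b => exists w, b = word w) a.

Lemma word_eq_linear (V : lmodType k) (f g : {linear R -> V}) :
  (forall w, f (word w) = g (word w)) -> f =1 g.
Proof. by move=> fg a; apply: eq_on_span (word_span a) => _ [w ->]. Qed.

(** The ideal is spanned by differences of two words that differ by one
    application of [r] to adjacent letters, so a linear map given on words
    kills it as soon as it does not see such a move. *)
Lemma YBrel_linear_vanish (r : Z * Z -> Z * Z) (V : lmodType k)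
    (h : seq Z -> V) (f : {linear R -> V}) :
    (forall w1 a b w2, h (w1 ++ [:: a; b] ++ w2) =
       h (w1 ++ [:: (r (a, b)).1; (r (a, b)).2] ++ w2)) ->
    (forall w, f (word w) = h w) ->
  forall u, ideal (YBrel X r) u -> f u = 0.
Proof.
move=> hr fw u /(YBrel_ideal_span word_span).
move: u; apply: span_min => [|c u v fu fv|].
- exact: linear0.
- by rewrite linearP /= fu fv scaler0 addr0.
move=> _ [_ [_ [_ [[w1 ->] [a [b ->]] [w2 ->] ->]]]].
have wE a' b' : word w1 * (X a' * X b') * word w2
    = word (w1 ++ [:: a'; b'] ++ w2).
  by rewrite !big_cat /= !big_cons big_nil mulr1 !mulrA.
by rewrite mulrBr mulrBl linearB /= !wE !fw hr subrr.
Qed.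

Lemma word_linear_monoid (R' : algType k) (G : Z -> R')
    (L : {linear R -> R'}) :
  (forall w, L (word w) = \prod_(z <- w) G z) -> monoid_morphism L.
Proof.
move=> Lw; split=> [|a b]; first by have := Lw [::]; rewrite !big_nil.
elim: (word_span a) => [|c _ a' [w ->] _ IH].
  by rewrite mul0r linear0 mul0r.
rewrite mulrDl -scalerAl !linearP IH /= mulrDl -scalerAl.
congr (_ *: _ + _).
elim: (word_span b) => [|d _ b' [w' ->] _ IH'].
  by rewrite mulr0 linear0 mulr0.
rewrite mulrDr -scalerAr !linearP IH' /= mulrDr -scalerAr.
by congr (_ *: _ + _); rewrite -big_cat !Lw big_cat.
Qed.

End WordMaps.

Lemma algquot_linear_lift (k : fieldType) (R : algType k) (S : R -> Prop)
    (S_proper : ~ ideal S 1) (V : lmodType k) (f : {linear R -> V}) :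
    (forall u, ideal S u -> f u = 0) ->
  exists L : {linear algquot S_proper -> V},
    forall u, L (algproj S_proper u) = f u.
Proof.
move=> f0; pose L (t : algquot S_proper) : V := f (repr t).
have LE u : L (algproj S_proper u) = f u.
  apply/eqP; rewrite -subr_eq0 -linearB; apply/eqP/f0.
  by apply/(algprojP S_proper); exact: projK.
have Llin : linear L.
  move=> c; elim/algprojW => u; elim/algprojW => v.
  have <- := algproj_is_linear S_proper c u v.
  by rewrite (LE u) (LE v) (LE (c *: u + v)) linearP.
pose Lm := GRing.isLinear.Build k _ V *:%R L Llin.
by exists (HB.pack L Lm : {linear algquot S_proper -> V}).
Qed.

Section YangBaxterMaps.
Variables (k : fieldType) (Z : finType) (r : Z * Z -> Z * Z).
Local Notation A := (YBalg k r).
Local Notation word w := (\prod_(z <- w) YBgen k r z).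

Lemma YBword_span (a : A) : span (fun b => exists w, b = word w) a.
Proof.
elim/algprojW: a => u.
apply: (span_map (f := algproj (@YBrel_proper k Z r))) (freeword_span u).
by move=> _ [w ->]; apply: span_mem; exists w; exact: YBproj_word.
Qed.

(** A linear map on the Yang-Baxter algebra is the same as a function on words
    that is invariant under [r]; both the coordinates of an element and the
    algebra maps below are obtained in this way. *)
Lemma YBalg_linear_lift (V : lmodType k) (h : seq Z -> V) :
    (forall w1 a b w2, h (w1 ++ [:: a; b] ++ w2) =
       h (w1 ++ [:: (r (a, b)).1; (r (a, b)).2] ++ w2)) ->
  exists L : {linear A -> V}, forall w, L (word w) = h w.
Proof.
move=> hr.
pose f : {linear freealg k Z -> V} := malg_lift (fun w : {fmonom Z} => h w).
have fw w : f (\prod_(z <- w) freegen k z) = h w.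
  by rewrite -(freewordE k (FMonom w)) /f /= malg_liftU.
have f0 := YBrel_linear_vanish (@freeword_span k Z) hr fw.
have [L LE] := algquot_linear_lift (@YBrel_proper k Z r) f0.
by exists L => w; rewrite -YBproj_word LE.
Qed.

(** The universal property of the algebra, deduced from the linear one: the
    products of the images of the letters form an invariant function on words,
    and the linear map so obtained is multiplicative on words. *)
Lemma YBalg_lift (R : algType k) (G : Z -> R) :
    (forall a b, G a * G b = G (r (a, b)).1 * G (r (a, b)).2) ->
  exists s : {lrmorphism A -> R}, forall z, s (YBgen k r z) = G z.
Proof.
move=> Gr.
have [|L Lw] := @YBalg_linear_lift R (fun w => \prod_(z <- w) G z).
  by move=> w1 a b w2; rewrite !big_cat /= !big_cons big_nil !mulr1 Gr.
pose g : A -> R := L.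
pose glin := GRing.isLinear.Build k A R *:%R g (linearP L).
pose gmon := GRing.isMonoidMorphism.Build A R g
  (word_linear_monoid YBword_span Lw).
pose s : {lrmorphism A -> R} := HB.pack g glin gmon.
by exists s => z; have := Lw [:: z]; rewrite !big_seq1.
Qed.

End YangBaxterMaps.

(** * Normal forms of words for a permutation solution *)

(** The length and the last letter of a word, which form a complete invariant,
    are encoded as a word, so that the empty word is no exception and maps of
    alphabets act letterwise. The default of [last] is never reached, as there
    is a letter only if the word is not empty. *)
Definition shadow (Z : Type) (w : seq Z) := [seq last z w | z <- w].

Lemma shadow_rcons (Z : Type) (w : seq Z) y :
  shadow (rcons w y) = nseq (size w).+1 y.
Proof.
rewrite -(size_rcons w y) /shadow.
rewrite (eq_map (g := fun=> y)) => [|z]; last by rewrite last_rcons.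
by elim: (rcons w y) => //= z v ->.
Qed.

Lemma shadow_map (Z Z' : Type) (p : Z -> Z') w :
  shadow (map p w) = map p (shadow w).
Proof.
by rewrite /shadow -!map_comp; apply: eq_map => z /=; rewrite last_map.
Qed.

Lemma shadow_rel (Z : Type) (w1 : seq Z) x y x' w2 :
  shadow (w1 ++ [:: x; y] ++ w2) = shadow (w1 ++ [:: x'; y] ++ w2).
Proof.
have lastE z a : last z (w1 ++ [:: a; y] ++ w2) = last y w2.
  by rewrite !last_cat.
rewrite /shadow; under eq_map do rewrite lastE.
by under [RHS]eq_map do rewrite lastE; rewrite !map_cat.
Qed.

Section PermutationSolution.
Variables (k : fieldType) (Z : finType) (g : {perm Z}).
Local Notation A := (YBalg k (perm_sol g)).
Local Notation X := (YBgen k (perm_sol g)).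
Local Notation word w := (\prod_(z <- w) X z).

Lemma perm_YBgenM a b : X a * X b = X (g b) * X b.
Proof.
rewrite -!(rmorphM (algproj _)); apply/algprojP/ideal_mem.
by exists a, b.
Qed.

(** Only the last letter matters: the letter before it may be replaced freely,
    then the one before that, and so on to the front of the word. *)
Lemma perm_word_last w w' y :
  size w = size w' -> word w * X y = word w' * X y.
Proof.
elim: w w' => [|a w IH] [|a' w'] //= [ww'].
rewrite !big_cons -!mulrA (IH _ ww').
case: w' {ww' IH} => [|b w']; first by rewrite big_nil !mul1r !(perm_YBgenM _ y).
by rewrite big_cons !mulrA (perm_YBgenM a) (perm_YBgenM a').
Qed.

Lemma perm_word_shadow w : word (shadow w) = word w.
Proof.
case/lastP: w => // w y.
rewrite shadow_rcons -[in nseq _ _]addn1 nseqD cats1 -!cats1 !big_cat !big_seq1.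
by apply: perm_word_last; rewrite size_nseq.
Qed.

(** The coordinates in the basis of normal words. They are faithful because a
    word and its normal form are equal in the algebra, so that evaluating
    normal words is a left inverse. *)
Lemma perm_coord : exists L : {linear A -> {malg k[seq Z]}},
  injective L /\ forall w, L (word w) = << shadow w >>.
Proof.
have [|L Lw] := @YBalg_linear_lift k Z (perm_sol g) {malg k[seq Z]}
    (fun w => << shadow w >>).
  by move=> w1 a b w2; rewrite (shadow_rel w1 a b (g b)).
exists L; split=> //.
pose rec : {linear {malg k[seq Z]} -> A} := malg_lift (fun w => word w).
apply: (can_inj (g := rec)) => a.
apply: (word_eq_linear (@YBword_span k Z (perm_sol g)) (f := rec \o L)
  (g := idfun)) => w /=.
by rewrite Lw /rec /= malg_liftU perm_word_shadow.
Qed.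

End PermutationSolution.

(** * Linear forms on tensor products and on free modules *)

Lemma tensor_functional (k : fieldType) (V W : lmodType k)
    (e : {linear V -> k^o}) (e' : {linear W -> k^o}) :
  exists E : {linear tensor V W -> k^o}, forall v w, E (tens v w) = e v * e' w.
Proof.
have el w : linear (fun v => e v * e' w : k^o).
  by move=> c v v'; rewrite linearP /= mulrDl -scalerAl.
have er v : linear (fun w => e v * e' w : k^o).
  by move=> c w w'; rewrite linearP /= mulrDr -scalerAr.
pose E := tensor_lift (fun v w => e v * e' w : k^o).
pose Elin := GRing.isLinear.Build k _ k^o *:%R E (tensor_lift_linear el er).
exists (HB.pack E Elin : {linear tensor V W -> k^o}) => v w.
exact: tensor_liftE el er v w.
Qed.

Section CoefficientForm.
Variables (k : fieldType) (K : choiceType) (w : K).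

Definition coef_form (u : {malg k[K]}) : k^o := u@_w.

Fact coef_form_is_linear : linear coef_form.
Proof. by move=> c u v; rewrite /coef_form mcoeffD mcoeffZ. Qed.
HB.instance Definition _ :=
  GRing.isLinear.Build k {malg k[K]} k^o *:%R coef_form coef_form_is_linear.

Lemma coef_formU w' : coef_form << w' >> = (w' == w)%:R.
Proof. exact: mcoeffU. Qed.

End CoefficientForm.

(** * The Segre map on words *)

(** Every letter z of C stands for the pair of letters [p z] and [q z]. *)
Section SegreWords.
Variables (k : fieldType) (A B : connGradedAlgType k) (C : connGradedAlgType k).
Variables (X Y Z : finType) (gX : X -> A) (gY : Y -> B) (gZ : Z -> C).
Variables (p : Z -> X) (q : Z -> Y) (s : {lrmorphism C -> tensor A B}).
Hypothesis s_gen : forall z, s (gZ z) = tens (gX (p z)) (gY (q z)).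

Lemma segre_word w : s (\prod_(z <- w) gZ z) =
  tens (\prod_(x <- map p w) gX x) (\prod_(y <- map q w) gY y).
Proof.
elim: w => [|z w IH]; first by rewrite !big_nil rmorph1.
by rewrite /= !big_cons rmorphM /= IH s_gen tens_mul.
Qed.

Hypothesis pq_inj : forall z z', p z = p z' -> q z = q z' -> z = z'.

Lemma pair_map_inj w w' : map p w = map p w' -> map q w = map q w' -> w = w'.
Proof.
elim: w w' => [|z w IH] [|z' w'] //= [pz pw] [qz qw].
by rewrite (pq_inj pz qz) (IH w').
Qed.

(** The coordinate of c along v equals the product form of the coordinates
    along [map p v] and [map q v] evaluated at s c. Both are linear in c, so it
    is enough to compare them on a word w: as taking shadows commutes with [p]
    and [q], it comes down to [shadow w = v] being equivalent to the equality
    of both projections. *)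
Lemma segre_inj (LA : {linear A -> {malg k[seq X]}})
    (LB : {linear B -> {malg k[seq Y]}}) (LC : {linear C -> {malg k[seq Z]}}) :
    (forall w, LA (\prod_(x <- w) gX x) = << shadow w >>) ->
    (forall w, LB (\prod_(y <- w) gY y) = << shadow w >>) ->
    (forall w, LC (\prod_(z <- w) gZ z) = << shadow w >>) ->
    injective LC ->
    (forall c, span (fun b => exists w, b = \prod_(z <- w) gZ z) c) ->
  injective s.
Proof.
move=> LAw LBw LCw LCinj Cspan.
suff s0 c : s c = 0 -> c = 0.
  move=> c c' /eqP; rewrite -subr_eq0 -linearB => /eqP /s0 /eqP.
  by rewrite subr_eq0 => /eqP.
move=> sc0; apply: LCinj; rewrite linear0; apply/malgP => v; rewrite mcoeff0.
have [E EE] := tensor_functional (coef_form (map p v) \o LA)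
  (coef_form (map q v) \o LB).
transitivity (E (s c)); last by rewrite sc0 linear0.
apply: (word_eq_linear Cspan (f := coef_form v \o LC) (g := E \o s)) => w /=.
rewrite segre_word EE /= LAw LBw LCw !shadow_map !coef_formU -natrM mulnb.
congr (_%:R); congr nat_of_bool.
apply/eqP/andP => [->|[/eqP pw /eqP qw]]; first by rewrite !eqxx.
exact: pair_map_inj.
Qed.

Hypothesis homogA : forall i a, homog i a <-> wordspan gX i a.
Hypothesis homogB : forall i b, homog i b <-> wordspan gY i b.
Hypothesis homogC : forall i c, homog i c <-> wordspan gZ i c.

Lemma segre_homog_image i c : homog i c -> segre_homog i (s c).
Proof.
move=> /homogC; move: c; apply: span_map => _ [w [<- ->]].
rewrite /= segre_word; apply: span_mem; eexists; eexists; split; last by [].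
- by apply/homogA/span_mem; exists (map p w); rewrite size_map.
- by apply/homogB/span_mem; exists (map q w); rewrite size_map.
Qed.

Hypothesis pq_surj : forall x y, exists z, p z = x /\ q z = y.

Lemma pair_map_surj u v :
  size u = size v -> exists w, map p w = u /\ map q w = v.
Proof.
elim: u v => [|x u IH] [|y v] //=; first by exists [::].
move=> [/IH[w [<- <-]]]; have [z [<- <-]] := pq_surj x y.
by exists (z :: w).
Qed.

(** A pure tensor of two words of length i is the image of the word of length i
    whose letters are the pairs of letters in the same place. *)
Lemma segre_homog_preimage i t :
  segre_homog i t -> exists c, homog i c /\ s c = t.
Proof.
pose P t := exists c, homog i c /\ s c = t.
have P0 : P 0 by exists 0; rewrite linear0; split=> //; exact: homog_0.
have PD d u v : P u -> P v -> P (d *: u + v).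
  move=> [c [ic <-]] [c' [ic' <-]]; exists (d *: c + c').
  by rewrite linearP; split=> //; exact: homog_lin.
move: t; apply: (span_min P0 PD) => _ [a [b [/homogA Ha /homogB Hb ->]]].
move: a Ha; apply: span_min => [|d a a' Pa Pa'|_ [u [iu ->]]].
- by rewrite (linear_fun0 (tens_linearl b)).
- by rewrite tens_linearl; exact: PD.
move: b Hb; apply: span_min => [|d b b' Pb Pb'|_ [v [iv ->]]].
- by rewrite (linear_fun0 (tens_linearr _)).
- by rewrite tens_linearr; exact: PD.
have [w [wu wv]] : exists w, map p w = u /\ map q w = v.
  by apply: pair_map_surj; rewrite iu iv.
exists (\prod_(z <- w) gZ z); rewrite segre_word wu wv; split=> //.
by apply/homogC/span_mem; exists w; rewrite -iu -wu size_map.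
Qed.

Lemma segre_image t : (exists c, s c = t) <-> t \in segre_pred A B.
Proof.
split=> [[c <-]|/segre_predP].
  apply/segre_predP; apply: (span_map (f := s)) (homog_full c) => c' [i ic'].
  by apply: span_mem; exists i; exact: segre_homog_image.
move: t; apply: span_min => [|d _ _ [c <-] [c' <-]|t [i it]].
- by exists 0; rewrite linear0.
- by exists (d *: c + c'); rewrite linearP.
- by have [c [_ <-]] := segre_homog_preimage it; exists c.
Qed.

(** An element of degree i in the image has a preimage of degree i, so
    injectivity makes the inverse graded as well. *)
Lemma segre_corestriction : injective s ->
  exists s1 : {lrmorphism C -> segre A B},
    (forall c, val (s1 c) = s c) /\ graded_iso s1.
Proof.
move=> s_inj.
have sP c : s c \in segre_pred A B by apply/segre_image; exists c.
pose g c : segre A B := exist _ (s c) (sP c).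
have glinP : linear g by move=> d c c'; apply: val_inj; exact: linearP.
have gmonP : monoid_morphism g.
  by split=> [|c c']; apply: val_inj; [exact: rmorph1|exact: rmorphM].
pose glin := GRing.isLinear.Build k C (segre A B) *:%R g glinP.
pose gmon := GRing.isMonoidMorphism.Build C (segre A B) g gmonP.
exists (HB.pack g glin gmon : {lrmorphism C -> segre A B}).
split=> //; split.
  have g_surj t : exists c, g c = t.
    have [c sc] : exists c, s c = val t by apply/segre_image; exact: valP.
    by exists c; apply: val_inj.
  exists (fun t => sval (cid (g_surj t))) => [c|t]; last by case: cid.
  by case: cid => c' /= /(congr1 val) /s_inj.
move=> i c; split=> [/segre_homog_preimage[c' [ic' /s_inj <-]]//|].
exact: segre_homog_image.
Qed.

End SegreWords.

(** * The isomorphism with the Segre product *)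

Theorem corollary7p14 (k : fieldType) (m n : nat) (X Y Z : finType)
    (x : 'I_m -> X) (y : 'I_n -> Y) (z : 'I_m -> 'I_n -> Z)
    (f : {perm X}) (phi : {perm Y}) (Phi : {perm Z}) :
  (2 <= m)%N -> (2 <= n)%N ->
  bijective x -> bijective y -> bijective (fun ia => z ia.1 ia.2) ->
  (forall i a p q,
     Phi (z i a) = z p q <-> f (x i) = x p /\ phi (y a) = y q) ->
  let A := YBalg k (perm_sol f) in
  let B := YBalg k (perm_sol phi) in
  let AZ := YBalg k (perm_sol Phi) in
  exists s : {lrmorphism AZ -> tensor A B},
    [/\ is_segre_map x y z s,
        forall s' : {lrmorphism AZ -> tensor A B},
          is_segre_map x y z s' -> s' =1 s,
        forall t : tensor A B, (exists u : AZ, s u = t) <-> t \in segre_pred A B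
      & exists s1 : {lrmorphism AZ -> segre A B},
          (forall u : AZ, val (s1 u) = s u) /\ graded_iso s1].
Proof.
move=> _ _ [x' xK x'K] [y' yK y'K] [z' zK z'K] PhiE A B AZ.
(* In the coordinates [p] and [q] on Z, the permutation Phi is f times phi. *)
pose p c := x (z' c).1; pose q c := y (z' c).2.
have pz i a : p (z i a) = x i by rewrite /p (zK (i, a)).
have qz i a : q (z i a) = y a by rewrite /q (zK (i, a)).
have pqPhi c : f (p c) = p (Phi c) /\ phi (q c) = q (Phi c).
  by apply/PhiE; rewrite (z'K c) (z'K (Phi c)).
have pq_inj c c' : p c = p c' -> q c = q c' -> c = c'.
  move=> /(can_inj xK) pc /(can_inj yK) qc.
  by rewrite -(z'K c) -(z'K c') pc qc.
have pq_surj b b' : exists c, p c = b /\ q c = b'.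
  by exists (z (x' b) (y' b')); rewrite pz qz x'K y'K.
have [|s s_gen] := @YBalg_lift k Z (perm_sol Phi) (tensor A B)
    (fun c => tens (YBgen k (perm_sol f) (p c)) (YBgen k (perm_sol phi) (q c))).
  move=> c d /=; rewrite !tens_mul -(pqPhi d).1 -(pqPhi d).2.
  by rewrite (perm_YBgenM k f) (perm_YBgenM k phi).
have homogE (U : finType) (g : {perm U}) i (a : YBalg k (perm_sol g)) :
  homog i a <-> wordspan (YBgen k (perm_sol g)) i a by [].
have s_inj : injective s.
  have [LA [_ LAw]] := perm_coord k f.
  have [LB [_ LBw]] := perm_coord k phi.
  have [LC [LC_inj LCw]] := perm_coord k Phi.
  exact: (segre_inj s_gen pq_inj LAw LBw LCw LC_inj (@YBword_span _ _ _)).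
exists s; split.
- by move=> i a; rewrite s_gen pz qz.
- move=> s' s'_gen.
  apply: (word_eq_linear (@YBword_span k Z (perm_sol Phi))) => w.
  have s'_gen' c : s' (YBgen k (perm_sol Phi) c) =
      tens (YBgen k (perm_sol f) (p c)) (YBgen k (perm_sol phi) (q c)).
    by rewrite -[c in LHS]z'K s'_gen.
  exact: etrans (segre_word s'_gen' w) (esym (segre_word s_gen w)).
- exact: (segre_image s_gen (homogE _ _) (homogE _ _) (homogE _ _) pq_surj).
- exact: (segre_corestriction s_gen (homogE _ _) (homogE _ _) (homogE _ _)
    pq_surj s_inj).
Qed.
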